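(* Assume the strong invariance principle holds with $\Delta_n=n^{1/4}\log(n)$, i.e. there are standard Brownian motions $\{B_t\}$, $\{B_t^*\}$ with $$\max_{1\le i\le n}|S_i-\tau B_i|=o_{\mathrm{a.s.}}(\Delta_n)\quad\text{and}\quad \max_{1\le i\le n}|S_i^*-\tau^*B_i^*|=o_{\mathrm{a.s.}}(\Delta_n).$$ Let $$\delta_n=\frac{r_n\Delta_n}{\Sigma_n}+\frac{r_n^*\Delta_n+\Sigma_n^{*2}}{\Sigma_n^2}$$ and assume $\delta_n\to0$. Let $c\in(0,1/2)$ be fixed. Under the null hypothesis $H_0$ of no change in mean, i.e. $X_i=\mu+\sigma_ie_i$ for $i=1,\ldots,n$ with $\mu$ constant, $$\max_{cn\le j\le(1-c)n}\bigl|T_n(j)-\tau\widetilde T_n(j)\bigr|=O_{\mathrm{p}}(\delta_n),$$ where $$T_n(j)=\frac{S_X(j)}{\sqrt{(1-j/n)^2\underline{V}_j^2+(j/n)^2\overline{V}_j^2}},\qquad S_X(j)=\Bigl(1-\frac jn\Bigr)\sum_{i=1}^jX_i-\frac jn\sum_{i=j+1}^nX_i,$$ $$\widetilde T_n(j)=\frac{(1-j/n)\sum_{i=1}^j\sigma_i(B_i-B_{i-1})-(j/n)\sum_{i=j+1}^n\sigma_i(B_i-B_{i-1})}{\sqrt{(1-j/n)^2\sum_{i=1}^j\sigma_i^2+(j/n)^2\sum_{i=j+1}^n\sigma_i^2}}.$$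
   Context: Setting: $\{e_i\}$ is a stationary time series with $E(e_i)=0$, $E(e_i^2)=1$; $\sigma_i>0$ are deterministic constants (which may depend on $n$). $S_i=\sum_{j=1}^ie_j$, $S_i^*=\sum_{j=1}^i(e_j^2-1)$. $\tau^2$ and $\tau^{*2}$ are the long-run variances of $\{e_i\}$ and $\{e_i^2-1\}$ (assumed well defined), where the long-run variance of a stationary process with autocovariances $\gamma_k$ is $\gamma_0+2\sum_{k\ge1}\gamma_k$; it is assumed that $\tau^2>0$, and $\tau>0$, $\tau^*\ge0$ are the square roots. Strong invariance principles are understood on a possibly enlarged probability space on which the process is redefined without changing its distribution; the two Brownian motions may be defined on different probability spaces. $B_0=0$. Notation: $\underline{X}_j=j^{-1}\sum_{i=1}^jX_i$, $\underline{V}_j^2=\sum_{i=1}^j(X_i-\underline{X}_j)^2$; $\overline{X}_j=(n-j)^{-1}\sum_{i=j+1}^nX_i$, $\overline{V}_j^2=\sum_{i=j+1}^n(X_i-\overline{X}_j)^2$; $r_n=|\sigma_n|+\sum_{i=2}^n|\sigma_i-\sigma_{i-1}|$, $r_n^*=|\sigma_n^2|+\sum_{i=2}^n|\sigma_i^2-\sigma_{i-1}^2|$; $\Sigma_n^2=\sum_{i=1}^n\sigma_i^2$, $\Sigma_n^{*2}=\bigl(\sum_{i=1}^n\sigma_i^4\bigr)^{1/2}$. $j$ ranges over integers. *)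

(* Defs.v *)
From HB Require Import structures.
From mathcomp Require Import all_boot all_order all_algebra.
From mathcomp Require Import all_classical all_reals all_analysis.

Set Implicit Arguments.
Unset Strict Implicit.
Unset Printing Implicit Defensive.

Import Order.TTheory GRing.Theory Num.Theory.
Import numFieldNormedType.Exports.

Local Open Scope classical_set_scope.
Local Open Scope ring_scope.

(* Time indices run over i >= 1; the value at index 0 of a sequence representing
   a series (e_i), (X_i) or (sigma_i) is never used. *)

Section probability_notions.
Context {R : realType}.

(* The random vector (e_(h+1), ..., e_(h+m)). *)
Definition block (d : measure_display) (T : measurableType d)
    (e : nat -> T -> R) (h m : nat) (w : T) : m.-tuple R :=
  [tuple e (h + i).+1 w | i < m].

Definition strictly_stationary (d : measure_display) (T : measurableType d)
    (P : probability T R) (e : nat -> T -> R) : Prop :=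
  forall (h m : nat) (A : set (m.-tuple R)), measurable A ->
    P (block e h m @^-1` A) = P (block e 0 m @^-1` A).

(* Equality in law of two processes, possibly living on different spaces. *)
Definition same_law (d d' : measure_display)
    (T : measurableType d) (T' : measurableType d')
    (P : probability T R) (e : nat -> T -> R)
    (P' : probability T' R) (e' : nat -> T' -> R) : Prop :=
  forall (m : nat) (A : set (m.-tuple R)), measurable A ->
    P (block e 0 m @^-1` A) = P' (block e' 0 m @^-1` A).

Definition autocov (d : measure_display) (T : measurableType d)
    (P : probability T R) (Y : nat -> T -> R) (k : nat) : R :=
  fine (covariance P (Y 1%N) (Y k.+1)).

(* The long-run variance of the stationary process Y is well defined (Y has
   finite second moments and the series of autocovariances converges), with
   value v. *)
Definition has_long_run_variance (d : measure_display) (T : measurableType d)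
    (P : probability T R) (Y : nat -> T -> R) (v : R) : Prop :=
  (forall i : nat, (1 <= i)%N -> Y i \in Lfun P 2%:E) /\
  (autocov P Y 0 + 2 * \sum_(1 <= k < n) autocov P Y k
     @[n --> \oo] --> v).

(* Taking some of the A i to be setT gives the product rule for subfamilies. *)
Definition mutually_independent (d : measure_display) (T : measurableType d)
    (P : probability T R) (m : nat) (X : 'I_m -> T -> R) : Prop :=
  forall A : 'I_m -> set R, (forall i, measurable (A i)) ->
    P [set w | forall i, A i (X i w)] = (\prod_(i < m) P (X i @^-1` A i))%E.

(* Only the times t >= 0 matter.  The second argument of normal_prob is the
   standard deviation. *)
Definition brownian_motion (d : measure_display) (T : measurableType d)
    (P : probability T R) (B : R -> {RV P >-> R}) : Prop :=
  [/\ {ae P, forall w, B 0 w = 0},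
      forall (m : nat) (t : nat -> R), 0 <= t 0%N ->
        (forall i, (i < m)%N -> t i <= t i.+1) ->
        mutually_independent P
          (fun (i : 'I_m) (w : T) => B (t i.+1) w - B (t i) w),
      forall (s t : R) (A : set R), 0 <= s -> s < t -> measurable A ->
        P [set w | A (B t w - B s w)] = normal_prob 0 (Num.sqrt (t - s)) A
    & {ae P, forall w, {within `[0, +oo[, continuous (fun t : R => B t w)}}].

Definition partial_sum (x : nat -> R) (i : nat) : R :=
  \sum_(1 <= k < i.+1) x k.

Definition strong_invariance (d : measure_display) (T : measurableType d)
    (P : probability T R) (Y : nat -> T -> R) (tau : R) (Delta : nat -> R)
    (B : R -> {RV P >-> R}) : Prop :=
  {ae P, forall w,
    (fun n : nat => \big[Num.max/0]_(1 <= i < n.+1)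
       `|partial_sum (Y^~ w) i - tau * B i%:R w| : R^o)
    =o_\oo (fun n => Delta n : R^o)}.

Definition bigO_in_probability (d : measure_display) (T : measurableType d)
    (P : probability T R) (Z : nat -> T -> R) (a : nat -> R) : Prop :=
  forall eps : R, 0 < eps -> exists2 M : R, 0 < M &
    \forall n \near \oo, (P [set w | (M * a n < `|Z n w|)%R] <= eps%:E)%E.

End probability_notions.

Section change_point.
Context {R : realType}.

Definition Delta (n : nat) : R := n%:R `^ (4^-1) * ln n%:R.

Section statistic.
Variables (n : nat) (X : nat -> R).

Definition mean_left (j : nat) : R := j%:R^-1 * \sum_(1 <= i < j.+1) X i.
Definition V2_left (j : nat) : R :=
  \sum_(1 <= i < j.+1) (X i - mean_left j) ^+ 2.
Definition mean_right (j : nat) : R :=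
  (n%:R - j%:R)^-1 * \sum_(j.+1 <= i < n.+1) X i.
Definition V2_right (j : nat) : R :=
  \sum_(j.+1 <= i < n.+1) (X i - mean_right j) ^+ 2.

Definition S_X (j : nat) : R :=
  (1 - j%:R / n%:R) * \sum_(1 <= i < j.+1) X i
  - j%:R / n%:R * \sum_(j.+1 <= i < n.+1) X i.

Definition T_stat (j : nat) : R :=
  S_X j / Num.sqrt ((1 - j%:R / n%:R) ^+ 2 * V2_left j
                    + (j%:R / n%:R) ^+ 2 * V2_right j).

End statistic.

Section scales.
(* sigma i stands for sigma_i at a fixed sample size n. *)
Variables (n : nat) (sigma : nat -> R).

Definition r_ : R :=
  `|sigma n| + \sum_(2 <= i < n.+1) `|sigma i - sigma i.-1|.
Definition r_star : R :=
  `|sigma n ^+ 2| + \sum_(2 <= i < n.+1) `|sigma i ^+ 2 - sigma i.-1 ^+ 2|.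
Definition Sigma : R := Num.sqrt (\sum_(1 <= i < n.+1) sigma i ^+ 2).
(* This is Sigma_n^{*2}, not its square root. *)
Definition Sigma_star2 : R := Num.sqrt (\sum_(1 <= i < n.+1) sigma i ^+ 4).

Definition delta_rate : R :=
  r_ * Delta n / Sigma + (r_star * Delta n + Sigma_star2) / Sigma ^+ 2.

(* b t stands for the value at time t of a Brownian path. *)
Definition T_tilde (b : R -> R) (j : nat) : R :=
  ((1 - j%:R / n%:R) *
     \sum_(1 <= i < j.+1) sigma i * (b i%:R - b i.-1%:R)
   - j%:R / n%:R *
     \sum_(j.+1 <= i < n.+1) sigma i * (b i%:R - b i.-1%:R))
  / Num.sqrt ((1 - j%:R / n%:R) ^+ 2 * \sum_(1 <= i < j.+1) sigma i ^+ 2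
              + (j%:R / n%:R) ^+ 2 * \sum_(j.+1 <= i < n.+1) sigma i ^+ 2).

End scales.
End change_point.

(* Main.v *)
Require Import Defs.
From HB Require Import structures.
From mathcomp Require Import all_boot all_order all_algebra.
From mathcomp Require Import all_classical all_reals all_analysis.
From mathcomp Require Import measurable_realfun.
From mathcomp Require Import ring lra.

Set Implicit Arguments.
Unset Strict Implicit.
Unset Printing Implicit Defensive.

Import Order.TTheory GRing.Theory Num.Theory.
Import numFieldNormedType.Exports.

Local Open Scope classical_set_scope.
Local Open Scope ring_scope.

(** Under the null hypothesis the mean [mu] cancels from [T_stat], and all
    reduces to weighted partial sums of the noise.

    Summation by parts bounds |sum_(i <= j) s_i y_i| by [r_ n s] times the
    largest partial sum of y.  For the weights sigma_i and
    y_i = e_i - tau (B_i - B_(i-1)), the invariance principle makes the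
    numerators of [T_stat] and tau [T_tilde] agree up to r_n Delta_n,
    uniformly in j.  For the weights sigma_i^2 and y_i = (e_i^2 - 1) -
    tau* (B*_i - B*_(i-1)) it shows that sum_(i <= j) sigma_i^2 (e_i^2 - 1)
    differs by at most r*_n Delta_n from a Gaussian random walk whose variance
    is proportional to sum sigma_i^4; hence the sums of squares in [V2_left] and
    [V2_right] are within r*_n Delta_n + Sigma*_n^2 of their means.  The second
    principle concerns a copy of the process on another space, but the event
    only depends on the law of (e_1, ..., e_n) ([same_law_weighted_sums]).

    The random walks that remain, sum_(i <= j) s_i (B_i - B_(i-1)), are bounded
    uniformly in j, in probability, by their standard deviation: this is
    Kolmogorov's maximal inequality ([kolmogorov_maximal]), proved by freezing
    the walk at its first exit from an interval.  The frozen walk is a Markov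
    chain, each of its states is independent of the next step, and its second
    moment is at most the sum of the variances of the steps.

    What the centring of the sums of squares costs is of relative order 1/n.
    This is at most delta_n because Cauchy-Schwarz gives
    Sigma*_n^2 >= Sigma_n^2 / sqrt n.  Finally j/n stays in [c, 1 - c], so
    the squared denominator of [T_tilde] is at least c^2 Sigma_n^2, and relative
    errors of order delta_n in the denominator and in the numerator give an
    error of order delta_n in the quotient ([studentized_perturbation],
    [T_stat_close]). *)

(** * Kolmogorov's maximal inequality *)

Lemma measurable_exceeds {R : realType} {d : measure_display}
    {T : measurableType d} (J : pred nat) (f : nat -> T -> R) (a : R) :
  (forall j, measurable_fun setT (f j)) ->
  measurable [set w | exists2 j, J j & a < `|f j w|].
Proof.
move=> mf.
rewrite (_ : [set w | _] = \bigcup_(j in [set j | J j]) [set w | a < `|f j w|]) //.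
apply: bigcup_measurable => j _.
have mfj : measurable_fun setT (fun w => `|f j w|) by exact: measurableT_comp.
have /(_ measurableT [set true] I) := measurable_fun_ltr (measurable_cst a) mfj.
by rewrite setTI.
Qed.

(** Independence of X, Y and the event D on rectangles extends to all events
    about the pair (X, Y): both sides are finite measures in E, so uniqueness of
    product measures applies.  Keeping D lets the lemma be iterated along a
    sequence, with D carrying the constraints on the variables to come. *)
Lemma joint_law_product (d d1 d2 : measure_display) (T : measurableType d)
    (T1 : measurableType d1) (T2 : measurableType d2) (R : realType)
    (P : probability T R) (X : {RV P >-> T1}) (Y : {RV P >-> T2}) (D : set T) :
  measurable D ->
  (forall A B, measurable A -> measurable B ->
     P (X @^-1` A `&` Y @^-1` B `&` D) = P (X @^-1` A) * P (Y @^-1` B) * P D)%E ->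
  forall E, measurable E ->
    P ((fun w => (X w, Y w)) @^-1` E `&` D)
    = ((distribution P X \x distribution P Y) E * P D)%E.
Proof.
move=> mD indep E mE.
pose XY : T -> T1 * T2 := fun w => (X w, Y w).
have mXY : measurable_fun setT XY by exact: measurable_fun_pair.
pose rho := pushforward (mrestr P mD) XY.
pose k : {nonneg R} := NngNum (fine_ge0 (measure_ge0 P D)).
have kE : (k%:num)%:E = P D by rewrite /= fineK // fin_num_measure.
pose m1 := distribution P X; pose m2 := distribution P Y.
have := @product_measure_unique _ _ _ _ _ m1 (mscale k m2).
move=> uniq.
transitivity (((distribution P X) \x mscale k m2)%E E).
  apply/esym; have := uniq rho; apply => //.
  move=> A B mA mB; rewrite /= /mscale kE /rho /pushforward /mrestr.
  have -> : XY @^-1` (A `*` B) = X @^-1` A `&` Y @^-1` B by [].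
  by rewrite indep // -muleA [(P D * _)%E]muleC.
rewrite (uniq (mscale k (m1 \x m2)%E) _ E mE); first by rewrite muleC -kE.
move=> A B mA mB.
transitivity ((k%:num)%:E * (m1 A * m2 B))%E; last by rewrite muleCA.
by congr (_ * _)%E; exact: product_measure1E.
Qed.

Section kolmogorov.
Context {R : realType} {d : measure_display} {T : measurableType d}.
Variables (P : probability T R) (xi : nat -> {RV P >-> R}).
Implicit Types (lam : R) (a : nat -> R).

(** The walk sum_(i < k) a i * x i is frozen as soon as it leaves
    [- lam, lam], which turns a statement about its maximum into one about its
    last value. *)
Fixpoint stopped_walk lam a (x : nat -> R) (k : nat) : R :=
  if k is k'.+1 then
    let s := stopped_walk lam a x k' in
    if `|s| <= lam then s + a k' * x k' else s
  else 0.

Lemma stopped_walkP lam a (x : nat -> R) (n : nat) :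
  `|stopped_walk lam a x n| <= lam ->
  forall k, (k <= n)%N -> `|\sum_(i < k) a i * x i| <= lam.
Proof.
move=> sn.
suff [_ + k kn] : stopped_walk lam a x n = \sum_(i < n) a i * x i /\
    forall k, (k <= n)%N -> `|\sum_(i < k) a i * x i| <= lam by exact.
elim: n sn => [|n IH] /=.
  rewrite big_ord0 => l0; split => // k.
  by rewrite leqn0 => /eqP ->; rewrite big_ord0.
case: ifPn => [sn|/negP //]; have [eS le_lam] := IH sn.
rewrite eS => sn1; split; first by rewrite big_ord_recr.
move=> k; rewrite leq_eqVlt => /predU1P[->|]; first by rewrite big_ord_recr.
by rewrite ltnS; exact: le_lam.
Qed.

Hypothesis indep : forall m, mutually_independent P (fun (i : 'I_m) => xi i).

Lemma measurable_stopped_walk lam a (k : nat) :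
  measurable_fun setT (fun w => stopped_walk lam a (xi ^~ w) k).
Proof.
elim: k => [|k IH] /=; first exact: measurable_cst.
apply: measurable_fun_ifT => //.
- by apply: measurable_fun_ler => //; exact: measurableT_comp.
- by apply: measurable_funD => //; exact: measurable_funM.
Qed.

Definition stopped lam a (k : nat) : T -> R :=
  fun w => stopped_walk lam a (xi ^~ w) k.

HB.instance Definition _ lam a k :=
  isMeasurableFun.Build _ _ _ _ (stopped lam a k)
    (measurable_stopped_walk lam a k).

(** The constraint put on the steps that the walk has not used yet. *)
Let box (m : nat) (C : 'I_m -> set R) : set T :=
  [set w | forall i, C i (xi i w)].

Let measurable_box m (C : 'I_m -> set R) :
  (forall i, measurable (C i)) -> measurable (box C).
Proof.
move=> mC; rewrite (_ : box C = \bigcap_(i in [set: 'I_m]) (xi i @^-1` C i)).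
  apply: fin_bigcap_measurable => [|i _]; first exact: finite_finset.
  exact: measurable_funPTI.
by apply/seteqP; split => [w Cw i _|w Cw i]; [exact: Cw|exact: Cw].
Qed.

Let stopped_joint_box lam a (m k : nat) (km : (k < m)%N) :
  (forall (C : 'I_m -> set R) A, measurable A -> (forall i, measurable (C i)) ->
     (forall i : 'I_m, (i < k)%N -> C i = setT) ->
     P (stopped lam a k @^-1` A `&` box C)
     = (P (stopped lam a k @^-1` A) * P (box C))%E) ->
  forall (C : 'I_m -> set R) E, measurable E -> (forall i, measurable (C i)) ->
    (forall i : 'I_m, (i < k.+1)%N -> C i = setT) ->
    P ((fun w => (stopped lam a k w, xi k w)) @^-1` E `&` box C)
    = ((distribution P (stopped lam a k) \x distribution P (xi k)) E
       * P (box C))%E.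
Proof.
move=> IH C E mE mC Ck.
apply: (joint_law_product (measurable_box mC)) => // A B mA mB.
(* C leaves step k unconstrained, so the event on xi k can be encoded there. *)
pose C' := fun i : 'I_m => if i == k :> nat then B else C i.
have mC' i : measurable (C' i) by rewrite /C'; case: ifP.
have Ck' (i : 'I_m) : (i < k)%N -> C' i = setT.
  by move=> ik; rewrite /C' ltn_eqF // Ck // ltnW.
have -> : stopped lam a k @^-1` A `&` xi k @^-1` B `&` box C
    = stopped lam a k @^-1` A `&` box C'.
  rewrite -setIA; congr (_ `&` _); apply/seteqP; split => w /=.
    by move=> [Bw Cw] i; rewrite /C'; case: eqP => [->|_] //; exact: Cw.
  move=> C'w; split; first by have := C'w (Ordinal km); rewrite /C' /= eqxx.
  move=> i; have := C'w i; rewrite /C'; case: eqP => // ik _.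
  by rewrite Ck // ik.
rewrite IH // -muleA; congr (_ * _)%E.
rewrite (indep mC') (indep mC) (bigD1 (Ordinal km)) //=.
rewrite [in RHS](bigD1 (Ordinal km)) //= /C' /= eqxx.
rewrite (Ck (Ordinal km)) // preimage_setT probability_setT mul1e.
congr (_ * _)%E; apply: eq_bigr => i ik.
by rewrite ifF //; apply/negbTE.
Qed.

(** The frozen walk at time k is independent of the steps from k on.  The
    induction works on the real-valued state alone, since the state at time
    k.+1 is a function of the state at time k and of step k. *)
Let stopped_box lam a (m k : nat) (C : 'I_m -> set R) A : (k <= m)%N ->
  measurable A -> (forall i, measurable (C i)) ->
  (forall i : 'I_m, (i < k)%N -> C i = setT) ->
  P (stopped lam a k @^-1` A `&` box C)
  = (P (stopped lam a k @^-1` A) * P (box C))%E.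
Proof.
elim: k C A => [|k IH] C A km mA mC Ck.
  have [A0|A0] := pselect (A 0).
    rewrite (_ : stopped lam a 0 @^-1` A = setT) ?setTI ?probability_setT
      ?mul1e //.
    by apply/seteqP; split.
  rewrite (_ : stopped lam a 0 @^-1` A = set0) ?set0I ?measure0 ?mul0e //.
  by apply/seteqP; split.
pose phi (z : R * R) := if `|z.1| <= lam then z.1 + a k * z.2 else z.1.
have mphi : measurable_fun setT phi.
  apply: measurable_fun_ifT => //.
  - by apply: measurable_fun_ler => //; exact: measurableT_comp.
  - by apply: measurable_funD => //; exact: measurable_funM.
have mE : measurable (phi @^-1` A).
  by rewrite -[X in measurable X]setTI; exact: mphi.
have jb := @stopped_joint_box lam a _ _ km (fun C A mA mC => IH C A (ltnW km) mA mC).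
have -> : stopped lam a k.+1 @^-1` A
    = (fun w => (stopped lam a k w, xi k w)) @^-1` (phi @^-1` A) by [].
have boxT : box (fun _ : 'I_m => setT) = setT by apply/seteqP; split.
have := jb (fun=> setT) _ mE (fun=> measurableT) (fun _ _ => erefl).
rewrite boxT setIT probability_setT mule1 => ->.
exact: jb.
Qed.

Lemma stopped_joint_law lam a (k : nat) E : measurable E ->
  P ((fun w => (stopped lam a k w, xi k w)) @^-1` E)
  = (distribution P (stopped lam a k) \x distribution P (xi k))%E E.
Proof.
move=> mE.
have := @stopped_joint_box lam a k.+1 k (ltnSn k)
  (fun C A mA mC => @stopped_box lam a k.+1 k C A (leqnSn k) mA mC)
  (fun=> setT) E mE (fun=> measurableT) (fun _ _ => erefl).
rewrite (_ : box _ = setT) ?setIT ?probability_setT ?mule1 //.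
by apply/seteqP; split.
Qed.

Lemma square_integrable_integrable (Y : {RV P >-> R}) (V : R) :
  ('E_P[fun w => (Y w ^+ 2)%R] <= V%:E)%E ->
  P.-integrable setT (fun w => (Y w ^+ 2)%:E) /\
  P.-integrable setT (fun w => (Y w)%:E).
Proof.
rewrite unlock => EY2.
have iY2 : P.-integrable setT (fun w => (Y w ^+ 2)%:E).
  apply/integrableP; split.
    by apply/measurable_EFinP; exact: measurable_funX.
  under eq_integral do rewrite /= ger0_norm ?sqr_ge0 //.
  exact: le_lt_trans EY2 (ltry _).
split=> //.
have i1 : P.-integrable setT (fun=> 1%:E).
  exact: finite_measure_integrable_cst.
(* The domination used is |Y| <= 1 + Y^2. *)
apply: (le_integrable _ _ _ (integrableD _ i1 iY2)) => //.
  exact/measurable_EFinP.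
move=> w _ /=; rewrite lee_fin [leRHS]ger0_norm; last by nra.
by rewrite -[Y w ^+ 2]real_normK ?num_real //; nra.
Qed.

Lemma centered_second_moment (Y : {RV P >-> R}) (x b V : R) :
  ('E_P[Y] = 0)%E -> ('E_P[fun w => (Y w ^+ 2)%R] <= V%:E)%E ->
  (\int[P]_w ((x + b * Y w) ^+ 2)%:E <= (x ^+ 2 + b ^+ 2 * V)%:E)%E.
Proof.
move=> EY EY2; have [iY2 iY] := square_integrable_integrable EY2.
rewrite !unlock in EY EY2.
rewrite (_ : (fun w => _) = (fun w => (x ^+ 2)%:E +
    ((2 * x * b)%:E * (Y w)%:E + (b ^+ 2)%:E * (Y w ^+ 2)%:E)))%E; last first.
  by apply/funext => w; rewrite -!EFinM -!EFinD; congr EFin; ring.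
rewrite integralD //=; last 2 first.
- exact: finite_measure_integrable_cst.
- by apply: integrableD => //; exact: integrableZl.
rewrite integralD //=; [|exact: integrableZl..].
rewrite !integralZl // EY mule0 add0e integral_cst //= probability_setT mule1.
rewrite EFinD leeD2lE // [leRHS]EFinM.
by apply: lee_wpmul2l; rewrite ?lee_fin ?sqr_ge0.
Qed.

Variable V : R.
Hypothesis centered : forall i, ('E_P[xi i] = 0)%E.
Hypothesis second_moment : forall i, ('E_P[fun w => (xi i w ^+ 2)%R] <= V%:E)%E.

(** By the product form of the joint law, each step can be integrated out with
    the current state x held fixed: it adds at most a_k^2 V when the walk still
    runs, because the step is centred, and nothing once the walk is frozen. *)
Lemma stopped_second_moment lam a (k : nat) :
  (\int[P]_w (stopped lam a k w ^+ 2)%:E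
   <= (V * \sum_(i < k) a i ^+ 2)%:E)%E.
Proof.
elim: k => [|k IH].
  rewrite big_ord0 mulr0 /stopped /=.
  by under eq_integral do rewrite expr0n /=; rewrite integral0.
have V0 : 0 <= V.
  rewrite -lee_fin (le_trans _ (second_moment 0)) // unlock.
  by apply: integral_ge0 => w _; rewrite lee_fin sqr_ge0.
pose NX (w : T) := (stopped lam a k w, xi k w).
have mNX : measurable_fun setT NX by exact: measurable_fun_pair.
pose f (z : R * R) : \bar R :=
  ((if `|z.1| <= lam then z.1 + a k * z.2 else z.1) ^+ 2)%:E.
have mf : measurable_fun setT f.
  apply/measurable_EFinP; apply: measurable_funX.
  apply: measurable_fun_ifT => //.
  - by apply: measurable_fun_ler => //; exact: measurableT_comp.
  - by apply: measurable_funD => //; exact: measurable_funM.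
have f0 z : (0 <= f z)%E by rewrite lee_fin sqr_ge0.
have -> : (\int[P]_w (stopped lam a k.+1 w ^+ 2)%:E
    = \int[distribution P (stopped lam a k)]_x
        \int[distribution P (xi k)]_y f (x, y))%E.
  rewrite -fubini_tonelli1 //.
  transitivity (\int[pushforward P NX]_z f z)%E.
    by rewrite ge0_integral_pushforward.
  apply: eq_measure_integral => // E mE _.
  exact: stopped_joint_law.
apply: (@le_trans _ _ (\int[distribution P (stopped lam a k)]_x
   (x ^+ 2 + a k ^+ 2 * V)%:E)%E).
  apply: ge0_le_integral => //.
  - by move=> x _; apply: integral_ge0 => y _; exact: f0.
  - exact: measurable_fun_fubini_tonelli_F.
  - by apply/measurable_EFinP; apply: measurable_funD => //; exact: measurable_funX.
  move=> x _; rewrite ge0_integral_distribution //; last first.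
    exact: (measurableT_comp mf (pair1_measurable x)).
  rewrite /f /comp /=; case: (`|x| <= lam); first exact: centered_second_moment.
  rewrite integral_cst //= probability_setT mule1 lee_fin lerDl.
  by rewrite mulr_ge0 // sqr_ge0.
under eq_integral do rewrite EFinD.
rewrite ge0_integralD //; last 3 first.
- by move=> x _; rewrite lee_fin sqr_ge0.
- by apply/measurable_EFinP; exact: measurable_funX.
- by move=> x _; rewrite lee_fin mulr_ge0 ?sqr_ge0.
rewrite integral_cst //= probability_setT mule1 big_ord_recr /= mulrDr EFinD.
rewrite (mulrC V (a k ^+ 2)) leeD2r // ge0_integral_distribution //.
- by apply/measurable_EFinP; exact: measurable_funX.
- by move=> x; rewrite lee_fin sqr_ge0.
Qed.

Let walk_exceeds lam a (n : nat) : set T :=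
  [set w | exists2 k, (k <= n)%N & lam < `|\sum_(i < k) a i * xi i w|].

(** Kolmogorov's maximal inequality, obtained from Markov's inequality for the
    square of the frozen walk. *)
Lemma kolmogorov_maximal lam a (n : nat) : 0 < lam ->
  (P (walk_exceeds lam a n)
   <= (V * (\sum_(i < n) a i ^+ 2) / lam ^+ 2)%:E)%E.
Proof.
move=> lam0.
have sub : walk_exceeds lam a n
    `<=` [set w | lam%:E <= `|(stopped lam a n w)%:E|]%E.
  move=> w [k kn lamk]; rewrite /= lee_fin leNgt; apply/negP => /ltW sn.
  by have := stopped_walkP sn kn; rewrite leNgt lamk.
have mstop : measurable [set w | lam%:E <= `|(stopped lam a n w)%:E|]%E.
  have mS : measurable_fun setT (fun w => `|stopped lam a n w|).
    exact: measurableT_comp.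
  rewrite -[X in measurable X]setTI.
  have := measurable_fun_ler (@measurable_cst _ _ _ _ setT lam) mS.
  by move=> /(_ measurableT [set true] I).
apply: (le_trans (le_measure _ _ _ sub)); rewrite ?inE //.
  apply: measurable_exceeds => k; apply: measurable_sum => i.
  exact: measurable_funM.
rewrite EFinM muleC lee_pdivlMl ?exprn_gt0 //.
apply: le_trans (stopped_second_moment lam a n).
have := @markov _ _ _ P (stopped lam a n) (fun r => r ^+ 2) lam lam0
  (exprn_measurable 2) (fun r _ => sqr_ge0 r).
rewrite unlock => mk; apply: (le_trans (mk _)) => [x y x0 y0 xy|].
  by rewrite lerXn2r.
by under eq_integral do rewrite /= real_normK ?num_real //.
Qed.

End kolmogorov.

(** * Random walks with Brownian steps *)

Section standard_normal.
Context {R : realType}.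
Notation leb := (@lebesgue_measure R).

Lemma ge0_integral_normal_prob (m s : R) (f : R -> \bar R) :
  measurable_fun setT f -> (forall x, 0 <= f x)%E ->
  (\int[normal_prob m s]_x f x = \int[leb]_x (f x * (normal_pdf m s x)%:E))%E.
Proof.
move=> mf f0; pose nu : probability _ R := normal_prob m s.
have dom : (nu `<< leb)%E by exact: normal_prob_dominates.
rewrite -(Radon_Nikodym_SigmaFinite.change_of_variables dom) //.
have int_g := Radon_Nikodym_SigmaFinite.f_integrable dom.
have mg := measurable_int _ int_g.
apply: ae_eq_integral => //.
- exact: emeasurable_funM.
- apply: emeasurable_funM => //; apply/measurable_EFinP.
  exact: measurable_normal_pdf.
- apply: ae_eqe_mul2l; apply: integral_ae_eq => //.
    by apply/measurable_EFinP; exact: measurable_normal_pdf.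
  by move=> E _ mE; rewrite -Radon_Nikodym_SigmaFinite.f_integral.
Qed.

Lemma normal_prob_opp (s : R) (A : set R) : s != 0 -> measurable A ->
  normal_prob 0 s (-%R @^-1` A) = normal_prob 0 s A.
Proof.
move=> s0 mA; rewrite /normal_prob.
transitivity (\int[pushforward leb (-%R : _ -> measurableTypeR R)]_(x in A)
   (normal_pdf 0 s x)%:E)%E.
  rewrite ge0_integral_pushforward //.
  - apply: eq_integral => x _; congr EFin.
    by rewrite /comp !normal_pdfE // /normal_fun !subr0 sqrrN.
  - by apply/measurable_EFinP/measurable_funTS; exact: measurable_normal_pdf.
  - by move=> x _; rewrite lee_fin normal_pdf_ge0.
by apply: eq_measure_integral => /= B mB _; exact: lebesgue_measureN.
Qed.

(** Only finiteness matters.  The bound x^2 exp(- x^2 / 2) <= 4 exp(- x^2 / 4)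
    compares the integrand with a multiple of the normal density of standard
    deviation sqrt 2. *)
Lemma normal_second_moment : exists V : R,
  (\int[normal_prob 0 1]_x (x ^+ 2)%:E <= V%:E)%E.
Proof.
have s2 : Num.sqrt 2 != 0 :> R by rewrite gt_eqF // sqrtr_gt0.
pose c : R := 4 * normal_peak 1 / normal_peak (Num.sqrt 2).
have peak2 : 0 < normal_peak (Num.sqrt 2 : R) by exact: normal_peak_gt0.
have c0 : 0 <= c.
  by rewrite /c divr_ge0 // ?mulr_ge0 // normal_peak_ge0.
exists c; rewrite ge0_integral_normal_prob //; last 2 first.
- by apply/measurable_EFinP; exact: exprn_measurable.
- by move=> x; rewrite lee_fin sqr_ge0.
apply: (@le_trans _ _ (\int[leb]_x (c%:E * (normal_pdf 0 (Num.sqrt 2) x)%:E))%E).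
  apply: ge0_le_integral => //.
  - by move=> x _; rewrite mule_ge0 // lee_fin ?sqr_ge0 ?normal_pdf_ge0.
  - apply: emeasurable_funM; apply/measurable_EFinP.
      exact: exprn_measurable.
    exact: measurable_normal_pdf.
  - apply: emeasurable_funM => //; apply/measurable_EFinP.
    exact: measurable_normal_pdf.
  move=> x _; rewrite -!EFinM lee_fin !normal_pdfE ?oner_neq0 //.
  have -> g : c * (normal_peak (Num.sqrt 2) * g) = normal_peak 1 * (4 * g).
    by rewrite /c; field; rewrite gt_eqF.
  rewrite mulrCA.
  apply: ler_wpM2l; first exact: normal_peak_ge0.
  rewrite /normal_fun !subr0 sqr_sqrtr // expr1n.
  have -> : - x ^+ 2 / (1 *+ 2) = - x ^+ 2 / (2 *+ 2) + - x ^+ 2 / (2 *+ 2).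
    by field.
  rewrite expRD mulrA; apply: ler_wpM2r; first exact: expR_ge0.
  (* It remains that x^2 <= 4 exp (x^2 / 4), from 1 + t <= exp t. *)
  have := expR_ge1Dx (x ^+ 2 / 4).
  have -> : - x ^+ 2 / (2 *+ 2) = - (x ^+ 2 / 4).
    by field.
  by rewrite expRN ler_pdivrMr ?expR_gt0 //; lra.
rewrite ge0_integralZl //; last 2 first.
- by apply/measurable_EFinP; exact: measurable_normal_pdf.
- by move=> x _; rewrite lee_fin normal_pdf_ge0.
by rewrite integral_normal_pdf mule1.
Qed.

End standard_normal.

Section symmetric.
Context {R : realType} {d : measure_display} {T : measurableType d}.
Variables (P : probability T R) (X : {RV P >-> R}).

Lemma expectation_symmetric :
  (forall A : set R, measurable A ->
     P (X @^-1` (-%R @^-1` A)) = P (X @^-1` A)) ->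
  P.-integrable setT (fun w => (X w)%:E) -> ('E_P[X] = 0)%E.
Proof.
move=> sym iX; rewrite unlock.
have EN : (\int[P]_w (X w)%:E = - \int[P]_w (X w)%:E)%E.
  have mN : measurable_fun setT (-%R \o X) by exact: measurableT_comp.
  transitivity (\int[pushforward P (-%R \o X)]_y y%:E)%E.
    transitivity (\int[distribution P X]_y y%:E)%E.
      by rewrite integral_distribution.
    apply: eq_measure_integral => A mA _.
    by rewrite /= /distribution /pushforward -sym.
  rewrite integral_pushforward //=.
    by rewrite -integralN // integrable_add_def.
  rewrite (_ : _ \o _ = (fun w => - (X w)%:E)%E) //; exact: integrableN.
have fin := integrable_fin_num measurableT iX.
move: EN; rewrite -(fineK fin) -EFinN => -[] EN; congr EFin; lra.
Qed.

End symmetric.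

Section brownian_walk.
Context {R : realType} {d : measure_display} {T : measurableType d}.
Variables (P : probability T R) (B : R -> {RV P >-> R}).

Definition increment (i : nat) (w : T) : R := B i.+1%:R w - B i%:R w.

Lemma measurable_increment i : measurable_fun setT (increment i).
Proof. exact: measurable_funB. Qed.

HB.instance Definition _ i :=
  isMeasurableFun.Build _ _ _ _ (increment i) (measurable_increment i).

Hypothesis brownianB : brownian_motion B.

Lemma independent_increments m :
  mutually_independent P (fun (i : 'I_m) => increment i).
Proof.
have [_ indep _ _] := brownianB.
apply: (indep m (fun i => i%:R)) => // i _.
by rewrite ler_nat.
Qed.

Lemma law_increment i (A : set R) : measurable A ->
  P (increment i @^-1` A) = normal_prob 0 1 A.
Proof.
move=> mA; have [_ _ law _] := brownianB.
rewrite [LHS](law i%:R i.+1%:R) ?ltr_nat //.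
by rewrite -natrB // subSnn sqrtr1.
Qed.

Lemma increment_second_moment (V : R) i :
  (\int[normal_prob 0 1]_x (x ^+ 2)%:E <= V%:E)%E ->
  ('E_P[fun w => (increment i w ^+ 2)%R] <= V%:E)%E.
Proof.
rewrite unlock => /(le_trans _); apply.
have mf : measurable_fun [set: R] (fun x : R => (x ^+ 2)%:E).
  by apply/measurable_EFinP; exact: exprn_measurable.
pose xi : T -> measurableTypeR R := increment i.
have mxi : measurable_fun setT xi by exact: measurable_increment.
rewrite (_ : (\int[P]_w _)%E
    = (\int[pushforward P xi]_x (x ^+ 2)%:E)%E); last first.
  by rewrite ge0_integral_pushforward // => x; rewrite lee_fin sqr_ge0.
rewrite le_eqVlt; apply/orP; left; apply/eqP.
by apply: eq_measure_integral => A mA _; exact: law_increment.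
Qed.

Lemma brownian_walk_maximal : exists V : R,
  forall (a : nat -> R) (n : nat) (lam : R), 0 < lam ->
  (P [set w | exists2 k, (k <= n)%N &
         (lam < `|\sum_(i < k) a i * (B i.+1%:R w - B i%:R w)|)%R]
   <= (V * (\sum_(i < n) a i ^+ 2) / lam ^+ 2)%:E)%E.
Proof.
have [V VP] := normal_second_moment (R := R).
exists V => a n lam lam0.
apply: (@kolmogorov_maximal _ _ _ P (fun i => increment i : {RV P >-> R})) => //.
- exact: independent_increments.
- move=> i; apply: expectation_symmetric.
    move=> A mA; rewrite !law_increment ?normal_prob_opp ?oner_neq0 //.
    by rewrite -[X in measurable X]setTI; exact: oppr_measurable.
  by have [] := square_integrable_integrable (increment_second_moment i VP).
- by move=> i; exact: increment_second_moment.
Qed.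

End brownian_walk.

(** * Bounds along one path *)

Section deterministic.
Context {R : realType}.

(** Summation by parts: sum_(i <= j) s_i y_i equals
    s_j Y_j - sum_(2 <= i <= j) (s_i - s_(i-1)) Y_(i-1), where Y is the sequence
    of partial sums of y, and |s_j| is at most |s_n| plus the variation of s
    beyond j. *)
Lemma sum_by_parts_bound (n : nat) (s y : nat -> R) (K : R) : 0 <= K ->
  (forall i, (1 <= i <= n)%N -> `|partial_sum y i| <= K) ->
  forall j, (j <= n)%N -> `|\sum_(1 <= i < j.+1) s i * y i| <= r_ n s * K.
Proof.
move=> K0 yK [|j] jn.
  rewrite big_geq // normr0 mulr_ge0 // addr_ge0 //.
  by apply: sumr_ge0 => i _.
pose v (m p : nat) := \sum_(m <= i < p.+1) `|s i - s i.-1|.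
have tail : `|s j.+1| <= `|s n| + v j.+2 n.
  have [k nE] : exists k, n = (j.+1 + k)%N.
    by exists (n - j.+1)%N; rewrite subnKC.
  rewrite {}nE {jn yK} /v; elim: k => [|k IH].
    by rewrite addn0 big_geq // addr0.
  rewrite addnS big_nat_recr /=; last by rewrite !ltnS leq_addr.
  have := ler_normB (s (j.+1 + k).+1) (s (j.+1 + k).+1 - s (j.+1 + k)%N).
  by rewrite subKr => tri; apply: (le_trans IH); rewrite addrA [leRHS]addrAC lerD2r.
have parts : `|\sum_(1 <= i < j.+2) s i * y i - s j.+1 * partial_sum y j.+1|
    <= v 2 j.+1 * K.
  elim: j jn {tail} => [|j IH] jn.
    by rewrite /partial_sum !big_nat1 subrr normr0 /v big_geq // mul0r.
  rewrite big_nat_recr //= /v [X in _ <= X * _]big_nat_recr //= mulrDl.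
  have -> : partial_sum y j.+2 = partial_sum y j.+1 + y j.+2.
    by rewrite /partial_sum big_nat_recr.
  set A := \sum_(1 <= i < j.+2) _.
  have -> : A + s j.+2 * y j.+2 - s j.+2 * (partial_sum y j.+1 + y j.+2)
     = (A - s j.+1 * partial_sum y j.+1)
       - (s j.+2 - s j.+1) * partial_sum y j.+1 by ring.
  apply: (le_trans (ler_normB _ _)); apply: lerD; first exact: IH (ltnW jn).
  by rewrite normrM ler_wpM2l // yK // (ltnW jn).
have -> : r_ n s = `|s n| + v j.+2 n + v 2 j.+1.
  rewrite /r_ -addrA [v j.+2 n + _]addrC; congr (_ + _).
  by rewrite /v (@big_cat_nat _ _ _ j.+2).
rewrite mulrDl -[X in `|X|](subrK (s j.+1 * partial_sum y j.+1)) addrC.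
apply: (le_trans (ler_normD _ _)); apply: lerD => //.
by rewrite normrM; apply: ler_pM => //; apply: yK; rewrite jn.
Qed.

Lemma sum_sqr_dev_mean (m p : nat) (y : nat -> R) (N : R) :
  N = (p - m)%:R -> N != 0 ->
  \sum_(m <= i < p) (y i - N^-1 * \sum_(m <= i < p) y i) ^+ 2
  = \sum_(m <= i < p) y i ^+ 2 - (\sum_(m <= i < p) y i) ^+ 2 / N.
Proof.
move=> NE N0; set S := \sum_(m <= i < p) y i.
under eq_bigr do rewrite sqrrB.
rewrite big_split /= sumrB sumr_const_nat -[_ *+ (p - m)]mulr_natr -NE.
by rewrite sumrMnl -mulr_suml -/S; field.

Qed.

(** With a = sqrt D and a' = sqrt D', the difference of the quotients is
    (N - tau N') / a - tau N' (D - D') / (a a' (a + a')); the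
    hypotheses on D and D' bound a' below by c S and a by c S / 2. *)
Lemma studentized_perturbation (N N' D D' Q S c tau K H dlt eta : R) :
  0 < c -> 0 < S -> S ^+ 2 = Q -> 0 <= tau -> 0 <= K -> 0 <= H ->
  0 <= dlt -> 0 <= eta ->
  c ^+ 2 * Q <= D' -> `|D - D'| <= H * dlt * Q -> H * dlt <= c ^+ 2 / 2 ->
  `|N - tau * N'| <= eta * S -> `|N'| <= K * S ->
  `|N / Num.sqrt D - tau * (N' / Num.sqrt D')|
  <= 2 * eta / c + 2 * tau * K * H * dlt / c ^+ 3.
Proof.
move=> c0 S0 SQ tau0 K0 H0 dlt0 eta0 D'ge DD' small NN' N'K.
set a := Num.sqrt D; set a' := Num.sqrt D'.
have Q0 : 0 < Q by rewrite -SQ exprn_gt0.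
have Dlow : (c * S / 2) ^+ 2 <= D.
  have := ler_norml (D - D') (H * dlt * Q); rewrite DD' => /esym/andP[+ _].
  have : H * dlt * Q <= c ^+ 2 / 2 * Q by rewrite ler_pM2r.
  have : (c * S / 2) ^+ 2 = c ^+ 2 * Q / 4 by rewrite -SQ; field.
  have : 0 <= c ^+ 2 * Q by rewrite mulr_ge0 ?sqr_ge0 ?ltW.
  lra.
have sqrt_ge (x z : R) : 0 < x -> x ^+ 2 <= z -> x <= Num.sqrt z.
  by move=> x0 /ler_wsqrtr; apply: le_trans; rewrite sqrtr_sqr ler_norm.
have cS : 0 < c * S by rewrite mulr_gt0.
have a_ge : c * S / 2 <= a by rewrite sqrt_ge // divr_gt0.
have a'_ge : c * S <= a' by rewrite sqrt_ge // exprMn SQ.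
have a0 : 0 < a by apply: lt_le_trans a_ge; rewrite divr_gt0.
have a'0 : 0 < a' by exact: lt_le_trans a'_ge.
have aD : a ^+ 2 = D by rewrite sqr_sqrtr // (le_trans _ Dlow) ?sqr_ge0.
have a'D : a' ^+ 2 = D'.
  by rewrite sqr_sqrtr // (le_trans _ D'ge) // mulr_ge0 ?sqr_ge0 ?ltW.
have -> : N / a - tau * (N' / a')
    = (N - tau * N') / a - tau * N' * (D - D') / (a * a' * (a + a')).
  by rewrite -aD -a'D; field; rewrite !gt_eqF ?addr_gt0.
apply: (le_trans (ler_normB _ _)); apply: lerD.
  rewrite normrM normfV (gtr0_norm a0) ler_pdivrMr //.
  apply: (le_trans NN'); apply: (@le_trans _ _ (2 * eta / c * (c * S / 2))).
    by rewrite le_eqVlt; apply/orP; left; apply/eqP; field; rewrite gt_eqF.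
  by rewrite ler_wpM2l // divr_ge0 ?mulr_ge0 // ltW.
have prod_ge : c ^+ 3 * S ^+ 3 / 2 <= a * a' * (a + a').
  have -> : c ^+ 3 * S ^+ 3 / 2 = (c * S / 2) * (c * S) * (c * S) by field.
  have le0 : 0 <= c * S / 2 by rewrite divr_ge0 ?ltW.
  have aa' : c * S / 2 * (c * S) <= a * a' by apply: ler_pM => //; exact: ltW.
  apply: ler_pM => //; [by rewrite mulr_ge0 // ltW | exact: ltW | lra].
have prod0 : 0 < c ^+ 3 * S ^+ 3 / 2 by rewrite divr_gt0 // mulr_gt0 // exprn_gt0.
rewrite normrM normfV [X in _ / X]gtr0_norm; last exact: lt_le_trans prod_ge.
rewrite ler_pdivrMr; last exact: lt_le_trans prod_ge.
apply: (@le_trans _ _ (2 * tau * K * H * dlt / c ^+ 3 * (c ^+ 3 * S ^+ 3 / 2))).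
  have -> : 2 * tau * K * H * dlt / c ^+ 3 * (c ^+ 3 * S ^+ 3 / 2)
      = tau * (K * S) * (H * dlt * Q).
    by rewrite -SQ; field; rewrite gt_eqF.
  rewrite !normrM (ger0_norm tau0); apply: ler_pM; rewrite ?mulr_ge0 //.
  by apply: ler_wpM2l.
by apply: ler_wpM2l => //; rewrite divr_ge0 ?mulr_ge0 ?exprn_ge0 // ltW.
Qed.

End deterministic.

Section path_bound.
Context {R : realType}.
Implicit Types (n j : nat) (sigma e X : nat -> R) (b : R -> R).

Lemma sum_tail (f : nat -> R) n j : (j <= n)%N ->
  \sum_(j.+1 <= i < n.+1) f i
  = \sum_(1 <= i < n.+1) f i - \sum_(1 <= i < j.+1) f i.
Proof.
by move=> jn; rewrite [in RHS](@big_cat_nat _ _ _ j.+1) //= addrAC subrr add0r.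
Qed.

Lemma Delta_ge0 n : 0 <= Delta n :> R.
Proof.
rewrite /Delta mulr_ge0 ?powR_ge0 //; case: n => [|n]; first by rewrite ln0.
by rewrite ln_ge0 // ler1n.
Qed.

Lemma r_ge0 n sigma : 0 <= r_ n sigma.
Proof. by rewrite addr_ge0 // sumr_ge0. Qed.

(** Since the empirical variance of the sigma_i^2 is nonnegative,
    (sum sigma_i^2)^2 / n <= sum sigma_i^4. *)
Lemma mean_sqr_le n sigma : (0 < n)%N ->
  (\sum_(1 <= i < n.+1) sigma i ^+ 2) / n%:R <= Sigma_star2 n sigma.
Proof.
move=> n0; set Q := \sum_(1 <= i < n.+1) _.
have nR : n%:R != 0 :> R by rewrite pnatr_eq0 -lt0n.
have n1 : 1 <= n%:R :> R by rewrite ler1n.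
have := @sum_sqr_dev_mean R 1 n.+1 (fun i => sigma i ^+ 2) n%:R.
rewrite subSS subn0 => /(_ erefl nR); rewrite -/Q => dev.
have Q4 : Q ^+ 2 / n%:R <= \sum_(1 <= i < n.+1) sigma i ^+ 4.
  rewrite (eq_bigr (fun i => (sigma i ^+ 2) ^+ 2)) => [|i _]; last by rewrite -exprM.
  by rewrite -subr_ge0 -dev; apply: sumr_ge0 => i _; rewrite sqr_ge0.
have Q0 : 0 <= Q by apply: sumr_ge0 => i _; rewrite sqr_ge0.
rewrite -[leLHS]ger0_norm ?divr_ge0 // -sqrtr_sqr; apply: ler_wsqrtr.
apply: le_trans Q4; rewrite exprMn ler_wpM2l ?sqr_ge0 // expr2.
by rewrite ler_piMl ?invr_ge0 // invf_le1 // (lt_le_trans ltr01).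
Qed.

Variables (n : nat) (sigma e X : nat -> R) (b : R -> R) (mu tau c K1 K2 : R).
Hypotheses (n_gt0 : (0 < n)%N)
  (sigma_gt0 : forall i, (1 <= i <= n)%N -> 0 < sigma i)
  (XE : forall i, (1 <= i <= n)%N -> X i = mu + sigma i * e i)
  (tau_ge0 : 0 <= tau) (c_gt0 : 0 < c) (K1_ge0 : 0 <= K1) (K2_ge0 : 0 <= K2).

(* The sums up to j entering the statistics: variances, noise, Brownian noise,
   and centred squares of the noise. *)
Let Q j := \sum_(1 <= i < j.+1) sigma i ^+ 2.
Let A j := \sum_(1 <= i < j.+1) sigma i * e i.
Let W j := \sum_(1 <= i < j.+1) sigma i * (b i%:R - b i.-1%:R).
Let E j := \sum_(1 <= i < j.+1) sigma i ^+ 2 * (e i ^+ 2 - 1).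
Let S := Sigma n sigma.
Let delta := delta_rate n sigma.

Lemma sum_sqr_gt0 : 0 < Q n.
Proof.
rewrite /Q big_nat_recr //=; apply: ltr_wpDl.
  by apply: sumr_ge0 => i _; rewrite sqr_ge0.
by rewrite exprn_gt0 // sigma_gt0 // n_gt0 leqnn.
Qed.

Lemma Sigma_gt0 : 0 < S. Proof. by rewrite sqrtr_gt0 sum_sqr_gt0. Qed.

Lemma Sigma_sqr : S ^+ 2 = Q n.
Proof. by rewrite sqr_sqrtr // ltW // sum_sqr_gt0. Qed.

(** The four terms of size delta_n; the last one absorbs the relative errors of
    order 1/n that come from centring the sums of squares. *)
Lemma delta_bounds : [/\ 0 <= delta, r_ n sigma * Delta n <= delta * S,
  r_star n sigma * Delta n + Sigma_star2 n sigma <= delta * Q n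
  & Q n / n%:R <= delta * Q n].
Proof.
have S0 := Sigma_gt0; have Q0 := sum_sqr_gt0.
have a0 : 0 <= r_ n sigma * Delta n by rewrite mulr_ge0 ?r_ge0 ?Delta_ge0.
have b0 : 0 <= r_star n sigma * Delta n.
  by rewrite mulr_ge0 ?Delta_ge0 //; exact: (r_ge0 n (fun i => sigma i ^+ 2)).
have s0 : 0 <= Sigma_star2 n sigma by exact: sqrtr_ge0.
have t1 : 0 <= r_ n sigma * Delta n / S by rewrite divr_ge0 // ltW.
have t2 : 0 <= (r_star n sigma * Delta n + Sigma_star2 n sigma) / Q n.
  by rewrite divr_ge0 ?addr_ge0 // ltW.
have dE : delta = r_ n sigma * Delta n / S
    + (r_star n sigma * Delta n + Sigma_star2 n sigma) / Q n.
  by rewrite -Sigma_sqr.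
split.
- by rewrite dE addr_ge0.
- by rewrite -ler_pdivrMr // dE lerDl.
- by rewrite -ler_pdivrMr // dE lerDr.
rewrite (le_trans (mean_sqr_le sigma n_gt0)) //.
apply: (@le_trans _ _ (r_star n sigma * Delta n + Sigma_star2 n sigma)).
  by rewrite lerDr.
by rewrite -ler_pdivrMr // dE lerDr.
Qed.

(* The three conditions on the path that hold with high probability. *)
Hypotheses
  (A_close : forall j, (j <= n)%N -> `|A j - tau * W j| <= r_ n sigma * Delta n)
  (W_le : forall j, (j <= n)%N -> `|W j| <= K1 * S)
  (E_le : forall j, (j <= n)%N ->
     `|E j| <= K2 * (r_star n sigma * Delta n + Sigma_star2 n sigma)).

(* [L * Sigma] bounds the weighted noise, and [H * delta] bounds the relative
   error of the squared denominator: the constants 3 = 1 + 2 and 5 = 1^2 + 2^2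
   add up the contributions of the left and right segments, the sums over the
   right one being differences of two sums from 1. *)
Let L := 1 + tau * K1.
Let H := 3 * K2 + 5 * L ^+ 2 / c.

Lemma weighted_noise_le j : delta <= 1 -> (j <= n)%N -> `|A j| <= L * S.
Proof.
move=> d1 jn; have [d0 rS _ _] := delta_bounds; have S0 := Sigma_gt0.
rewrite -[A j](subrK (tau * W j)) (le_trans (ler_normD _ _)) // mulrDl.
apply: lerD.
  by rewrite (le_trans (A_close jn)) // (le_trans rS) // ler_pM2r.
by rewrite normrM (ger0_norm tau_ge0) -mulrA ler_wpM2l // W_le.
Qed.

(** Covers the left and the right segment at once.  The sum of squared
    deviations is sum (sigma_i e_i)^2 - s^2 / N, where s is the weighted noise of the
    segment, so s^2 / N is of order Sigma^2 / (c n). *)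
Lemma V2_segment_close (m p : nat) (N a q : R) : delta <= 1 ->
  (1 <= m)%N -> (p <= n.+1)%N ->
  N = (p - m)%:R -> c * n%:R <= N ->
  `|\sum_(m <= i < p) sigma i * e i| <= a * (L * S) ->
  `|\sum_(m <= i < p) sigma i ^+ 2 * (e i ^+ 2 - 1)| <= q * (K2 * (delta * Q n)) ->
  `|\sum_(m <= i < p) (X i - N^-1 * \sum_(m <= i < p) X i) ^+ 2
    - \sum_(m <= i < p) sigma i ^+ 2|
  <= (q * K2 + a ^+ 2 * L ^+ 2 / c) * delta * Q n.
Proof.
move=> d1 m1 pn NE cN sumA sumE.
have [d0 _ _ Qn] := delta_bounds; have S0 := Sigma_gt0.
have nR : 0 < n%:R :> R by rewrite ltr0n.
have N0 : 0 < N by apply: lt_le_trans cN; rewrite mulr_gt0.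
set s := \sum_(m <= i < p) sigma i * e i in sumA *.
have XN : N^-1 * \sum_(m <= i < p) X i = mu + N^-1 * s.
  rewrite (eq_big_nat _ _ (F2 := fun i => mu + sigma i * e i)); last first.
    move=> i /andP[mi ip]; apply: XE; rewrite (leq_trans m1 mi) /=.
    by rewrite -ltnS (leq_trans ip).
  rewrite big_split /= sumr_const_nat -[mu *+ _]mulr_natr -NE -/s.
  by field; rewrite gt_eqF.
rewrite XN.
rewrite (eq_big_nat _ _ (F2 := fun i => (sigma i * e i - N^-1 * s) ^+ 2));
  last first.
  move=> i /andP[mi ip]; rewrite XE; last first.
    by rewrite (leq_trans m1 mi) /= -ltnS (leq_trans ip).
  by congr (_ ^+ 2); ring.
rewrite (sum_sqr_dev_mean _ NE) ?gt_eqF // -/s addrAC -sumrB.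
rewrite (eq_bigr (fun i => sigma i ^+ 2 * (e i ^+ 2 - 1))); last first.
  by move=> i _; ring.
rewrite (le_trans (ler_normB _ _)) // 2!mulrDl; apply: lerD.
  by rewrite (le_trans sumE) // !mulrA.
have s2 : s ^+ 2 <= a ^+ 2 * L ^+ 2 * Q n.
  rewrite -Sigma_sqr -!exprMn -mulrA -[s ^+ 2]real_normK ?num_real //.
  by rewrite lerXn2r ?nnegrE // (le_trans _ sumA).
rewrite ger0_norm ?divr_ge0 ?sqr_ge0 ?(ltW N0) //.
apply: (@le_trans _ _ (a ^+ 2 * L ^+ 2 * Q n / (c * n%:R))).
  apply: ler_pM => //; rewrite ?sqr_ge0 ?invr_ge0 ?(ltW N0) //.
  by rewrite lef_pV2 ?posrE // mulr_gt0.
have -> : a ^+ 2 * L ^+ 2 * Q n / (c * n%:R)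
   = a ^+ 2 * L ^+ 2 / c * (Q n / n%:R) by field; rewrite !gt_eqF.
rewrite -[leRHS]mulrA ler_wpM2l //.
by rewrite divr_ge0 ?(ltW c_gt0) // mulr_ge0 ?sqr_ge0.
Qed.

Lemma T_stat_close j : c * n%:R <= j%:R <= (1 - c) * n%:R ->
  delta <= 1 -> H * delta <= c ^+ 2 / 2 ->
  `|T_stat n X j - tau * T_tilde n sigma b j|
  <= (4 / c + 4 * tau * K1 * H / c ^+ 3) * delta.
Proof.
move=> /andP[cj jc] d1 Hd.
have [d0 rS rQ Qn] := delta_bounds; have S0 := Sigma_gt0; have Q0 := sum_sqr_gt0.
have nR : 0 < n%:R :> R by rewrite ltr0n.
have jn : (j < n)%N.
  by rewrite -(ltr_nat R) (le_lt_trans jc) // gtr_pMl // gtrBl.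
have j0 : (0 < j)%N by rewrite -(ltr_nat R) (lt_le_trans _ cj) // mulr_gt0.
have jn' := ltnW jn.
set u : R := j%:R / n%:R.
have uc : c <= u by rewrite ler_pdivlMr.
have u1c : u <= 1 - c by rewrite ler_pdivrMr.
have njR : n%:R - j%:R = (n - j)%:R :> R by rewrite natrB.
have L0 : 0 <= L by rewrite addr_ge0 ?mulr_ge0.
have H_ge0 : 0 <= H.
  by rewrite addr_ge0 ?divr_ge0 ?mulr_ge0 ?sqr_ge0 // ltW.
have EQ k : (k <= n)%N -> `|E k| <= K2 * (delta * Q n).
  by move=> kn; rewrite (le_trans (E_le kn)) // ler_wpM2l.
have left : `|V2_left X j - Q j|
    <= (1 * K2 + 1 ^+ 2 * L ^+ 2 / c) * delta * Q n.
  apply: V2_segment_close => //; rewrite ?subSS ?subn0 ?mul1r //.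
  - exact: weighted_noise_le.
  - exact: EQ.
have right : `|V2_right n X j - (Q n - Q j)|
    <= (2 * K2 + 2 ^+ 2 * L ^+ 2 / c) * delta * Q n.
  rewrite -(sum_tail (fun i => sigma i ^+ 2) jn').
  apply: V2_segment_close => //; rewrite ?subSS ?(sum_tail _ jn') //.
  - by rewrite njR; lra.
  - rewrite mulrDl mul1r (le_trans (ler_normB _ _)) // lerD //; exact: weighted_noise_le.
  - by rewrite mulrDl mul1r (le_trans (ler_normB _ _)) // lerD // EQ.
have SXE : S_X n X j = A j - u * A n.
  rewrite /S_X -/u.
  have sX p : (p <= n)%N -> \sum_(1 <= i < p.+1) X i = mu * p%:R + A p.
    move=> pn; rewrite (eq_big_nat _ _ (F2 := fun i => mu + sigma i * e i)).
      by rewrite big_split /= sumr_const_nat subSS subn0 mulr_natr.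
    move=> i /andP[i1 ip]; apply: XE; rewrite i1 /=.
    by rewrite -ltnS (leq_trans ip).
  by rewrite (sum_tail _ jn') !sX // /u; field; rewrite gt_eqF.
rewrite /T_stat SXE /T_tilde -/u !(sum_tail _ jn') -/(W j) -/(W n) -/(Q j) -/(Q n).
have -> : (1 - u) * W j - u * (W n - W j) = W j - u * W n by ring.
clearbody u.
have u0 : 0 <= u by rewrite (le_trans _ uc) // ltW.
have Qj0 : 0 <= Q j by apply: sumr_ge0 => i _; rewrite sqr_ge0.
have Qnj0 : 0 <= Q n - Q j.
  rewrite -(sum_tail (fun i => sigma i ^+ 2) jn').
  by apply: sumr_ge0 => i _; rewrite sqr_ge0.
have sq_le (x : R) : c <= x -> c ^+ 2 <= x ^+ 2.
  by move=> cx; rewrite lerXn2r ?nnegrE // ?(le_trans _ cx) // ltW.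
have shrink (x y : R) : 0 <= x <= 1 -> `|x * y| <= `|y|.
  by move=> /andP[x0 x1]; rewrite normrM ger0_norm // ler_piMl.
have uu : u <= 1 by rewrite (le_trans u1c) // gerBl ltW.
have u01 : 0 <= u <= 1 by rewrite u0.
apply: (@le_trans _ _
    (2 * (2 * delta) / c + 2 * tau * (2 * K1) * H * delta / c ^+ 3)).
  apply: (@studentized_perturbation _ _ _ _ _ (Q n) S) => //.
  - exact: Sigma_sqr.
  - by rewrite mulr_ge0.
  - by rewrite mulr_ge0.
  - rewrite -{1}[Q n](subrKC (Q j)) mulrDr; apply: lerD; apply: ler_wpM2r => //.
      by apply: sq_le; rewrite lerBrDl -lerBrDr.
    exact: sq_le.
  - rewrite opprD addrACA -!mulrBr (le_trans (ler_normD _ _)) //.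
    have v01 : 0 <= (1 - u) ^+ 2 <= 1.
      by rewrite sqr_ge0 expr_le1 ?gerBl // subr_ge0.
    have w01 : 0 <= u ^+ 2 <= 1 by rewrite sqr_ge0 expr_le1.
    have := shrink _ (V2_left X j - Q j) v01.
    have := shrink _ (V2_right n X j - (Q n - Q j)) w01.
    have -> : H * delta * Q n = (1 * K2 + 1 ^+ 2 * L ^+ 2 / c) * delta * Q n
       + (2 * K2 + 2 ^+ 2 * L ^+ 2 / c) * delta * Q n.
      by rewrite /H; field; rewrite gt_eqF.
    lra.
  - have -> : A j - u * A n - tau * (W j - u * W n)
        = (A j - tau * W j) - u * (A n - tau * W n) by ring.
    rewrite (le_trans (ler_normB _ _)) //.
    have := shrink _ (A n - tau * W n) u01.
    have := A_close jn'; have := A_close (leqnn n); lra.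
  - rewrite (le_trans (ler_normB _ _)) //.
    have := shrink _ (W n) u01.
    have := W_le jn'; have := W_le (leqnn n); lra.
by rewrite le_eqVlt; apply/orP; left; apply/eqP; field; rewrite gt_eqF.
Qed.

End path_bound.

(** * Bounds in probability for weighted sums *)

Section in_probability.
Context {R : realType} {d : measure_display} {T : measurableType d}.
Variable P : probability T R.

(** Almost sure convergence implies convergence in probability, by continuity
    from above along the events that some E n with n >= N occurs. *)
Lemma ae_eventually_probability (E : nat -> set T) :
  (forall n, measurable (E n)) ->
  {ae P, forall w, \forall n \near \oo, ~ E n w} ->
  forall eps : R, 0 < eps -> \forall n \near \oo, (P (E n) <= eps%:E)%E.
Proof.
move=> mE aeE eps eps0.
pose F N := \bigcup_(n in [set n | (N <= n)%N]) E n.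
have mF N : measurable (F N) by apply: bigcup_measurable => n _.
have mI : measurable (\bigcap_N F N) by exact: bigcap_measurable.
have PI0 : P (\bigcap_N F N) = 0%E.
  apply/(measure_negligible mI).
  apply: negligibleS aeE => w Fw /= [N _ nE].
  by have [n /= Nn Enw] := Fw N I; exact: nE Enw.
have : P \o F @ \oo --> P (\bigcap_N F N).
  apply: nonincreasing_cvg_mu => //.
    by rewrite (le_lt_trans (probability_le1 _ _)) ?ltry.
  apply/nonincreasing_seqP => N; apply/subsetPset => w [n /= Nn Enw].
  by exists n => //=; exact: ltnW.
rewrite PI0 => /fine_cvg /cvgrPdist_le /(_ _ eps0) [N _ NF].
exists N => // n Nn; have := NF n Nn; rewrite /= sub0r normrN.
have finF : P (F n) \is a fin_num by exact: fin_num_measure.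
rewrite ger0_norm ?fine_ge0 // => small.
apply: (@le_trans _ _ (P (F n))); last by rewrite -(fineK finF) lee_fin.
by apply: le_measure; rewrite ?inE // => w Enw; exists n => /=.
Qed.

End in_probability.

Section weighted_sums.
Context {R : realType} {d : measure_display} {T : measurableType d}.
Variables (P : probability T R) (B : R -> {RV P >-> R}).
Hypothesis brownianB : brownian_motion B.

Lemma weighted_increments_bounded (eps : R) : 0 < eps ->
  exists2 K : R, 0 < K & forall (n : nat) (s : nat -> R),
    0 < \sum_(1 <= i < n.+1) s i ^+ 2 ->
    (P [set w | exists2 j, (j <= n)%N &
          (K * Num.sqrt (\sum_(1 <= i < n.+1) s i ^+ 2)
           < `|\sum_(1 <= i < j.+1) s i * (B i%:R w - B i.-1%:R w)|)%R]
     <= eps%:E)%E.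
Proof.
move=> eps0; have [V maximal] := brownian_walk_maximal brownianB.
(* Chosen so that V / K^2 <= eps; the summand 1 makes K positive. *)
pose K := Num.sqrt (`|V| / eps) + 1.
have K0 : 0 < K by rewrite ltr_wpDl.
exists K => // n s Q0.
set Q := \sum_(1 <= i < n.+1) s i ^+ 2 in Q0 *.
have QE : \sum_(i < n) s i.+1 ^+ 2 = Q by rewrite /Q big_add1 big_mkord.
rewrite (_ : [set w | _] = [set w | exists2 k, (k <= n)%N &
    (K * Num.sqrt Q < `|\sum_(i < k) s i.+1 * (B i.+1%:R w - B i%:R w)|)%R]);
  last first.
  have walkE w k : \sum_(1 <= i < k.+1) s i * (B i%:R w - B i.-1%:R w)
      = \sum_(i < k) s i.+1 * (B i.+1%:R w - B i%:R w).
    by rewrite big_add1 big_mkord.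
  by apply/seteqP; split => w [k kn lt_k]; exists k => //; move: lt_k; rewrite walkE.
have KQ0 : 0 < K * Num.sqrt Q by rewrite mulr_gt0 ?sqrtr_gt0.
apply: (le_trans (maximal (fun i => s i.+1) n _ KQ0)); rewrite lee_fin QE.
rewrite exprMn sqr_sqrtr ?(ltW Q0) //.
rewrite -mulf_div divff ?gt_eqF // mulr1 ler_pdivrMr ?exprn_gt0 //.
apply: (le_trans (ler_norm V)); rewrite mulrC -ler_pdivrMr //.
have VE : 0 <= `|V| / eps by rewrite divr_ge0 ?(ltW eps0).
rewrite -{1}(sqr_sqrtr VE) lerXn2r ?nnegrE ?(ltW K0) //.
by rewrite lerDl.
Qed.

Variables (Y : nat -> T -> R) (tau : R).
Hypothesis mY : forall i, measurable_fun setT (Y i).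
Hypothesis sipY : strong_invariance Y tau Delta B.

(** The invariance principle bounds the partial sums of
    Y_i - tau (B_i - B_(i-1)), to which summation by parts applies. *)
Lemma weighted_sums_close (s : nat -> nat -> R) (eps : R) : 0 < eps ->
  \forall n \near \oo,
    (P [set w | exists2 j, (j <= n)%N &
          (r_ n (s n) * Delta n
           < `|\sum_(1 <= i < j.+1)
                 s n i * (Y i w - tau * (B i%:R w - B i.-1%:R w))|)%R]
     <= eps%:E)%E.
Proof.
move=> eps0.
pose far n := [set w | exists2 i, (1 <= i <= n)%N &
  Delta n < `|partial_sum (Y^~ w) i - tau * (B i%:R w - B 0 w)|].
have mfar n : measurable (far n).
  apply: measurable_exceeds => i; apply: measurable_funB.
    by apply: measurable_sum => k; exact: mY.
  by apply: measurable_funM => //; exact: measurable_funB.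
have aefar : {ae P, forall w, \forall n \near \oo, ~ far n w}.
  have [B0 _ _ _] := brownianB.
  apply: filterS2 B0 sipY => w B0 /eqoP /(_ 1 ltr01).
  apply: filterS => n /=; rewrite mul1r (ger0_norm (Delta_ge0 n)) => le_max [i i1n]; apply/negP.
  rewrite -leNgt B0 subr0.
  apply: le_trans le_max; apply: le_trans (ler_norm _).
  apply: (le_bigmax_seq 0 i xpredT
    (fun k => `|partial_sum (Y^~ w) k - tau * B k%:R w|)) => //.
  by rewrite mem_index_iota.
have := ae_eventually_probability mfar aefar eps0.
apply: filterS => n; apply: le_trans; apply: le_measure; rewrite ?inE //.
  apply: measurable_exceeds => j; apply: measurable_sum => i.
  apply: measurable_funM => //; apply: measurable_funB => //.
  by apply: measurable_funM => //; exact: measurable_funB.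
move=> w [j jn lt_j]; apply: contrapT => near_w.
suff : `|\sum_(1 <= i < j.+1)
      s n i * (Y i w - tau * (B i%:R w - B i.-1%:R w))|
    <= r_ n (s n) * Delta n by rewrite leNgt lt_j.
apply: (@sum_by_parts_bound _ n (s n)
  (fun i => Y i w - tau * (B i%:R w - B i.-1%:R w)) (Delta n)) => //.
  exact: Delta_ge0.
move=> i i1n.
have -> : partial_sum (fun i => Y i w - tau * (B i%:R w - B i.-1%:R w)) i
    = partial_sum (Y^~ w) i - tau * (B i%:R w - B 0 w).
  rewrite /partial_sum sumrB -mulr_sumr; congr (_ - _ * _).
  by rewrite big_add1 telescope_sumr.
by rewrite leNgt; apply/negP => lt_i; apply: near_w; exists i.
Qed.

Lemma weighted_sums_bounded (s : nat -> nat -> R) (eps : R) : 0 < eps ->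
  (forall n, (0 < n)%N -> 0 < \sum_(1 <= i < n.+1) s n i ^+ 2) ->
  exists2 K : R, 0 < K & \forall n \near \oo,
    (P [set w | exists2 j, (j <= n)%N &
          (K * (r_ n (s n) * Delta n
                + Num.sqrt (\sum_(1 <= i < n.+1) s n i ^+ 2))
           < `|\sum_(1 <= i < j.+1) s n i * Y i w|)%R]
     <= eps%:E)%E.
Proof.
move=> eps0 s_gt0; have eps2 : 0 < eps / 2 by rewrite divr_gt0.
have [K K0 walk] := weighted_increments_bounded eps2.
exists (1 + `|tau| * K); first by rewrite ltr_pwDl // mulr_ge0 // ltW.
have := weighted_sums_close s eps2.
apply: filterS2 (nbhs_infty_gt 0) => n n0 close.
have {}walk := walk n (s n) (s_gt0 n n0).
have mterm (f : nat -> T -> R) (J : pred nat) (a : R) :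
    (forall i, measurable_fun setT (f i)) ->
    measurable [set w |
      exists2 j, J j & a < `|\sum_(1 <= i < j.+1) s n i * f i w|].
  move=> mf; apply: measurable_exceeds => j; apply: measurable_sum => i.
  exact: measurable_funM.
have mdB i : measurable_fun setT (fun w => B i%:R w - B i.-1%:R w).
  exact: measurable_funB.
have mdiff i :
    measurable_fun setT (fun w => Y i w - tau * (B i%:R w - B i.-1%:R w)).
  by apply: measurable_funB => //; exact: measurable_funM.
have -> : eps%:E = ((eps / 2)%:E + (eps / 2)%:E)%E by rewrite -EFinD -splitr.
apply: le_trans (leeD close walk); apply: (le_trans _ (measureU2 _ _ _)).
- apply: le_measure; rewrite ?inE; [exact: mterm| |].
    by apply: measurableU; exact: mterm.
  move=> w [j jn lt_j]; apply: contrapT => /not_orP[far big].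
  have cl : `|\sum_(1 <= i < j.+1)
        s n i * (Y i w - tau * (B i%:R w - B i.-1%:R w))|
      <= r_ n (s n) * Delta n.
    by rewrite leNgt; apply/negP => lt; apply: far; exists j.
  have wk : `|\sum_(1 <= i < j.+1) s n i * (B i%:R w - B i.-1%:R w)|
      <= K * Num.sqrt (\sum_(1 <= i < n.+1) s n i ^+ 2).
    by rewrite leNgt; apply/negP => lt; apply: big; exists j.
  move: lt_j; apply/negP; rewrite -leNgt.
  have -> : \sum_(1 <= i < j.+1) s n i * Y i w
      = \sum_(1 <= i < j.+1) s n i * (Y i w - tau * (B i%:R w - B i.-1%:R w))
        + tau * \sum_(1 <= i < j.+1) s n i * (B i%:R w - B i.-1%:R w).
    by rewrite mulr_sumr -big_split /=; apply: eq_bigr => i _; ring.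
  apply: (le_trans (ler_normD _ _)); rewrite normrM.
  have := ler_wpM2l (normr_ge0 tau) wk.
  have : 0 <= r_ n (s n) * Delta n by rewrite mulr_ge0 ?r_ge0 ?Delta_ge0.
  have := sqrtr_ge0 (\sum_(1 <= i < n.+1) s n i ^+ 2).
  have : 0 <= `|tau| * K by rewrite mulr_ge0 // ltW.
  nra.
- exact: mterm.
- exact: mterm.
Qed.

End weighted_sums.

Section transfer.
Context {R : realType} {d d' : measure_display}
  {T : measurableType d} {T' : measurableType d'}.
Variables (P : probability T R) (P' : probability T' R).
Variables (e : nat -> {RV P >-> R}) (e' : nat -> {RV P' >-> R}).

(** The event is the inverse image, under (e_1, ..., e_n), of a Borel set that
    does not depend on the space. *)
Lemma same_law_weighted_sums (n : nat) (s : nat -> R) (a : R) :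
  same_law P e P' e' ->
  P [set w | exists2 j, (j <= n)%N &
       a < `|\sum_(1 <= i < j.+1) s i * (e i w ^+ 2 - 1)|]
  = P' [set w | exists2 j, (j <= n)%N &
       a < `|\sum_(1 <= i < j.+1) s i * (e' i w ^+ 2 - 1)|].
Proof.
move=> same.
pose A := [set t : n.-tuple R | exists2 j, (j <= n)%N &
  a < `|\sum_(1 <= i < j.+1) s i * (nth 0 t i.-1 ^+ 2 - 1)|].
have mA : measurable A.
  apply: measurable_exceeds => j; apply: measurable_sum => i.
  apply: measurable_funM => //; apply: measurable_funB => //.
  apply: measurable_funX; have [lt_i|ge_i] := ltnP i.-1 n.
    rewrite (_ : (fun t => _) = (@tnth n R)^~ (Ordinal lt_i)).
      exact: measurable_tnth.
    by apply/funext => t; rewrite (tnth_nth 0).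
  rewrite (_ : (fun t => _) = (fun=> 0)); first exact: measurable_cst.
  by apply/funext => t; rewrite nth_default // size_tuple.
have preE d0 (T0 : measurableType d0) (x : nat -> T0 -> R) :
    [set w | exists2 j, (j <= n)%N &
       a < `|\sum_(1 <= i < j.+1) s i * (x i w ^+ 2 - 1)|]
    = block x 0 n @^-1` A.
  have xE w j : (j <= n)%N ->
      \sum_(1 <= i < j.+1) s i * (nth 0 (block x 0 n w) i.-1 ^+ 2 - 1)
      = \sum_(1 <= i < j.+1) s i * (x i w ^+ 2 - 1).
    move=> jn; apply: eq_big_nat => -[//|i] ij; rewrite succnK.
    have ltin : (i < n)%N by apply: leq_trans jn.
    rewrite (_ : nth 0 _ _ = x i.+1 w) //.
    by rewrite -[i]/(nat_of_ord (Ordinal ltin)) -tnth_nth tnth_mktuple.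
  by apply/seteqP; split => w [j jn lt_j]; exists j => //; move: lt_j; rewrite xE.
by rewrite !preE; exact: same.
Qed.

End transfer.

(** * Measurability of the statistics *)

Section measurability.
Context {R : realType} {d : measure_display} {T : measurableType d}.
Implicit Types (f g : T -> R).

Lemma measurable_div_sqrt f g : measurable_fun setT f -> measurable_fun setT g ->
  measurable_fun setT (fun w => f w / Num.sqrt (g w)).
Proof.
move=> mf mg; apply: measurable_funM => //.
(* On nonnegative reals the inverse is the power -1, also at 0. *)
under eq_fun do rewrite -powR_inv1 ?sqrtr_ge0 //.
apply: (measurableT_comp (measurable_powR _)).
apply: (measurableT_comp _ mg); apply: continuous_measurable_fun.
exact: sqrt_continuous.
Qed.

Lemma measurable_T_stat (n j : nat) (X : nat -> T -> R) :
  (forall i, measurable_fun setT (X i)) ->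
  measurable_fun setT (fun w => T_stat n (X ^~ w) j).
Proof.
move=> mX.
have msum m p : measurable_fun setT (fun w => \sum_(m <= i < p) X i w).
  by apply: measurable_sum => i.
apply: measurable_div_sqrt.
  by apply: measurable_funB; apply: measurable_funM.
have mV (m p : nat) (a : R) : measurable_fun setT
    (fun w => \sum_(m <= i < p) (X i w - a * \sum_(m <= k < p) X k w) ^+ 2).
  apply: measurable_sum => i; apply: measurable_funX.
  by apply: measurable_funB => //; exact: measurable_funM.
apply: measurable_funD; apply: measurable_funM => //; exact: mV.
Qed.

Lemma measurable_T_tilde (n j : nat) (sigma : nat -> R) (b : R -> T -> R) :
  (forall t, measurable_fun setT (b t)) ->
  measurable_fun setT (fun w => T_tilde n sigma (b ^~ w) j).
Proof.
move=> mb.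
have msum m p : measurable_fun setT
    (fun w => \sum_(m <= i < p) sigma i * (b i%:R w - b i.-1%:R w)).
  apply: measurable_sum => i; apply: measurable_funM => //.
  exact: measurable_funB.
apply: measurable_div_sqrt => //.
by apply: measurable_funB; apply: measurable_funM.
Qed.

Lemma measurable_bigmax (I : Type) (r : seq I) (p : pred I) (h : I -> T -> R) :
  (forall i, measurable_fun setT (h i)) ->
  measurable_fun setT (fun w => \big[Num.max/0]_(i <- r | p i) h i w).
Proof.
move=> mh; elim: r => [|i r IH].
  by under eq_fun do rewrite big_nil; exact: measurable_cst.
under eq_fun do rewrite big_cons.
by case: (p i) => //; exact: measurable_maxr.
Qed.

End measurability.

Lemma eq_T_stat {R : realType} (n j : nat) (x y : nat -> R) : (j <= n)%N ->
  (forall i, (1 <= i <= n)%N -> x i = y i) -> T_stat n x j = T_stat n y j.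
Proof.
move=> jn xy.
have left (F : R -> R) :
    \sum_(1 <= i < j.+1) F (x i) = \sum_(1 <= i < j.+1) F (y i).
  apply: eq_big_nat => i /andP[i1 ij].
  by rewrite xy // i1 -ltnS (leq_trans ij).
have right (F : R -> R) :
    \sum_(j.+1 <= i < n.+1) F (x i) = \sum_(j.+1 <= i < n.+1) F (y i).
  apply: eq_big_nat => i /andP[ji ni].
  by rewrite xy // (leq_trans _ ji) //= -ltnS.
rewrite /T_stat /S_X /V2_left /V2_right /mean_left /mean_right.
rewrite (left id) (right id) (left (fun v => (v - _) ^+ 2)).
by rewrite (right (fun v => (v - _) ^+ 2)).
Qed.

(** * The strong approximation of the statistic *)

Theorem theorem2p3 (R : realType)
  (* the stationary series (e_i)_{i >= 1} *)
  (d : measure_display) (T : measurableType d) (P : probability T R)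
  (e : nat -> {RV P >-> R})
  (e_stationary : strictly_stationary P e)
  (e_mean : forall i : nat, (1 <= i)%N -> ('E_P[e i] = 0)%E)
  (e_var : forall i : nat, (1 <= i)%N -> ('E_P[fun w => (e i w ^+ 2)%R] = 1)%E)
  (tau tau_star : R) (tau_gt0 : 0 < tau) (tau_star_ge0 : 0 <= tau_star)
  (lrv : has_long_run_variance P e (tau ^+ 2))
  (lrv_star : has_long_run_variance P (fun i w => e i w ^+ 2 - 1)
                (tau_star ^+ 2))
  (* strong invariance principle for S: a copy e1 of e, together with B *)
  (d1 : measure_display) (T1 : measurableType d1) (P1 : probability T1 R)
  (e1 : nat -> {RV P1 >-> R}) (e1_law : same_law P e P1 e1)
  (B : R -> {RV P1 >-> R}) (B_brownian : brownian_motion B)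
  (sip : strong_invariance e1 tau Delta B)
  (* strong invariance principle for S^*: a copy e2 of e, together with B^* *)
  (d2 : measure_display) (T2 : measurableType d2) (P2 : probability T2 R)
  (e2 : nat -> {RV P2 >-> R}) (e2_law : same_law P e P2 e2)
  (Bstar : R -> {RV P2 >-> R}) (Bstar_brownian : brownian_motion Bstar)
  (sip_star : strong_invariance (fun i w => e2 i w ^+ 2 - 1)
                tau_star Delta Bstar)
  (* sigma n i is sigma_i at sample size n *)
  (sigma : nat -> nat -> R)
  (sigma_gt0 : forall n i : nat, (1 <= i <= n)%N -> 0 < sigma n i)
  (delta_cvg0 : delta_rate n (sigma n) @[n --> \oo] --> 0)
  (c : R) (c_gt0 : 0 < c) (c_lt_half : c < 1 / 2)
  (* the observations under H_0 *)
  (mu : R) (X : nat -> nat -> T1 -> R)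
  (H0 : forall (n i : nat) (w : T1), (1 <= i <= n)%N ->
     X n i w = mu + sigma n i * e1 i w) :
  bigO_in_probability P1
    (fun n w => \big[Num.max/0]_(0 <= j < n.+1 |
                   c * n%:R <= j%:R <= (1 - c) * n%:R)
       `|T_stat n (X n ^~ w) j - tau * T_tilde n (sigma n) (B ^~ w) j|)
    (fun n => delta_rate n (sigma n)).
Proof.
move=> eps eps0; have eps3 : 0 < eps / 3 by rewrite divr_gt0.
have Q_pos n : (0 < n)%N -> 0 < \sum_(1 <= i < n.+1) sigma n i ^+ 2.
  by move=> n0; apply: sum_sqr_gt0 => // i; exact: sigma_gt0.
have Q2_pos n : (0 < n)%N -> 0 < \sum_(1 <= i < n.+1) (sigma n i ^+ 2) ^+ 2.
  move=> n0; apply: (@sum_sqr_gt0 _ n (fun i => sigma n i ^+ 2)) => // i i1n.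
  by rewrite exprn_gt0 // sigma_gt0.
have me1 i : measurable_fun setT (e1 i) by [].
have [K1 K1_gt0 walk] := weighted_increments_bounded B_brownian eps3.
have close := weighted_sums_close B_brownian me1 sip sigma eps3.
have me2 i : measurable_fun setT (fun w => e2 i w ^+ 2 - 1).
  by apply: measurable_funB => //; exact: measurable_funX.
have [K2 K2_gt0 squares] := weighted_sums_bounded Bstar_brownian me2 sip_star
  eps3 Q2_pos.
(* The constants of [T_stat_close]. *)
pose H := 3 * K2 + 5 * (1 + tau * K1) ^+ 2 / c.
have H_gt0 : 0 < H.
  rewrite ltr_pwDl ?mulr_gt0 // divr_ge0 ?(ltW c_gt0) //.
  by rewrite mulr_ge0 // sqr_ge0.
pose M := 4 / c + 4 * tau * K1 * H / c ^+ 3.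
have M_gt0 : 0 < M by rewrite addr_gt0 // divr_gt0 ?exprn_gt0 // !mulr_gt0.
exists M => //.
have small : \forall n \near \oo,
    `|delta_rate n (sigma n)| < Num.min 1 (c ^+ 2 / 2 / H).
  apply: (cvgr0_norm_lt _ delta_cvg0).
  by rewrite lt_min ltr01 !divr_gt0 ?exprn_gt0.
near=> n.
have n0 : (0 < n)%N by near: n; exact: nbhs_infty_gt.
have delta_le1 : delta_rate n (sigma n) <= 1.
  apply/ltW/(le_lt_trans (ler_norm _)); near: n; apply: filterS small => n.
  by rewrite lt_min => /andP[].
have Hd : H * delta_rate n (sigma n) <= c ^+ 2 / 2.
  rewrite mulrC -ler_pdivlMr //.
  apply/ltW/(le_lt_trans (ler_norm _)); near: n; apply: filterS small => n.
  by rewrite lt_min => /andP[].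
(* [X n i] is only known, hence only measurable, for i between 1 and n. *)
pose X' i w := mu + sigma n i * e1 i w.
pose Z' w := \big[Num.max/0]_(0 <= j < n.+1 | c * n%:R <= j%:R <= (1 - c) * n%:R)
  `|T_stat n (X' ^~ w) j - tau * T_tilde n (sigma n) (B ^~ w) j|.
have ZE w : \big[Num.max/0]_(0 <= j < n.+1 | c * n%:R <= j%:R <= (1 - c) * n%:R)
    `|T_stat n (X n ^~ w) j - tau * T_tilde n (sigma n) (B ^~ w) j| = Z' w.
  rewrite /Z' big_nat_cond [RHS]big_nat_cond.
  apply: eq_bigr => j /andP[/andP[_ jn] _].
  by rewrite (@eq_T_stat _ n j _ (X' ^~ w)) // => i i1n; rewrite H0.
have mZ : measurable_fun setT Z'.
  apply: measurable_bigmax => j; apply: measurableT_comp => //.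
  apply: measurable_funB.
    apply: measurable_T_stat => i; apply: measurable_funD => //.
    exact: measurable_funM.
  by apply: measurable_funM => //; exact: measurable_T_tilde.
pose far := [set w | exists2 j, (j <= n)%N & r_ n (sigma n) * Delta n
  < `|\sum_(1 <= i < j.+1) sigma n i * (e1 i w - tau * (B i%:R w - B i.-1%:R w))|].
pose big_walk := [set w | exists2 j, (j <= n)%N & K1 * Sigma n (sigma n)
  < `|\sum_(1 <= i < j.+1) sigma n i * (B i%:R w - B i.-1%:R w)|].
pose big_squares := [set w | exists2 j, (j <= n)%N &
  K2 * (r_star n (sigma n) * Delta n + Sigma_star2 n (sigma n))
  < `|\sum_(1 <= i < j.+1) sigma n i ^+ 2 * (e1 i w ^+ 2 - 1)|].
have m_sum (f : nat -> T1 -> R) (s : nat -> R) (a : R) :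
    (forall i, measurable_fun setT (f i)) ->
    measurable [set w |
      exists2 j, (j <= n)%N & a < `|\sum_(1 <= i < j.+1) s i * f i w|].
  move=> mf; apply: measurable_exceeds => j; apply: measurable_sum => i.
  exact: measurable_funM.
have m_far : measurable far.
  by apply: m_sum => i; apply: measurable_funB => //; apply: measurable_funM => //;
    exact: measurable_funB.
have m_walk : measurable big_walk by apply: m_sum => i; exact: measurable_funB.
have m_squares : measurable big_squares.
  by apply: m_sum => i; apply: measurable_funB => //; exact: measurable_funX.
have P_far : (P1 far <= (eps / 3)%:E)%E by rewrite /far; near: n; exact: close.
have P_walk : (P1 big_walk <= (eps / 3)%:E)%E by exact: walk (Q_pos n n0).
have P_squares : (P1 big_squares <= (eps / 3)%:E)%E.
  rewrite /big_squares -(same_law_weighted_sums _ _ _ e1_law).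
  rewrite (same_law_weighted_sums _ _ _ e2_law).
  have -> : Sigma_star2 n (sigma n)
      = Num.sqrt (\sum_(1 <= i < n.+1) (sigma n i ^+ 2) ^+ 2).
    by congr Num.sqrt; apply: eq_bigr => i _; rewrite -exprM.
  near: n; exact: squares.
have sub : [set w | M * delta_rate n (sigma n) < `|Z' w|]
    `<=` far `|` big_walk `|` big_squares.
  move=> w /= lt_Z; apply: contrapT => /not_orP[/not_orP[near_w walk_w] squares_w].
  move: lt_Z; apply/negP; rewrite -leNgt.
  have Z0 : 0 <= Z' w by exact: bigmax_ge_id.
  have Q0 : 0 <= delta_rate n (sigma n).
    by have [] := @delta_bounds _ n (sigma n) n0 (sigma_gt0 n).
  rewrite (ger0_norm Z0) /Z'; apply: bigmax_le; first by rewrite mulr_ge0 // ltW.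
  move=> j cj.
  apply: (@T_stat_close _ n (sigma n) (e1 ^~ w) _ (B ^~ w) mu tau c K1 K2) => //.
  - exact: sigma_gt0.
  - exact: ltW.
  - exact: ltW.
  - exact: ltW.
  - move=> k kn; rewrite leNgt; apply/negP => lt_k; apply: near_w; exists k => //.
    move: lt_k; rewrite mulr_sumr -sumrB; congr (_ < `|_|).
    by apply: eq_bigr => i _; ring.
  - by move=> k kn; rewrite leNgt; apply/negP => lt_k; apply: walk_w; exists k.
  - by move=> k kn; rewrite leNgt; apply/negP => lt_k; apply: squares_w; exists k.
under eq_set do rewrite ZE.
apply: (le_trans (le_measure _ _ _ sub)); rewrite ?inE.
- rewrite -[X in measurable X]setTI.
  have mZn : measurable_fun setT (fun w => `|Z' w|) by exact: measurableT_comp.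
  have := measurable_fun_ltr (measurable_cst (M * delta_rate n (sigma n))) mZn.
  exact.
- by apply: measurableU => //; exact: measurableU.
have -> : eps%:E = ((eps / 3)%:E + (eps / 3)%:E + (eps / 3)%:E)%E.
  by rewrite -!EFinD; congr EFin; field.
apply: (le_trans (measureU2 _ (measurableU _ _ m_far m_walk) m_squares)).
apply: leeD => //; apply: (le_trans (measureU2 _ m_far m_walk)).
exact: leeD.
Unshelve. all: by end_near.
Qed.
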